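(* Let $G=(V,E)$ be a connected undirected graph with $n$ vertices. Then the randomized query complexity of local search on $G$ is $\Omega\left(\frac{n^{1.5}}{g}\right)$, where $g$ is the vertex congestion of $G$. (The $\Omega$ is uniform: there are absolute constants $c>0$ and $n_0$ such that for every connected undirected graph $G$ with $n\ge n_0$ vertices and vertex congestion $g$, the randomized query complexity of local search on $G$ is at least $c\,n^{1.5}/g$.)
   Context: Local search: $G=(V,E)$ is a finite connected undirected graph known to the algorithm, and $f:V\to\mathbb{R}$ is an unknown function accessible through an oracle; a query names a vertex $v$ and receives $f(v)$. A vertex $v$ is a local minimum if $f(v)\le f(u)$ for all $\{u,v\}\in E$. The task is to output a local minimum. Randomized query complexity: the minimum over randomized algorithms that, for every input $f$, output a correct solution with probability at least $9/10$, of the worst-case (over inputs) expected number of queries, the expectation being over the algorithm's coin tosses. Vertex congestion: an all-pairs set of paths in $G$ is a family $\mathcal{P}=\{P^{u,v}\}_{u,v\in V}$, where $P^{u,v}$ is a (simple) path in $G$ from $u$ to $v$, one for each ordered pair, with $P^{u,u}=(u)$. For a path $Q$, let $c_v^Q$ be the number of times vertex $v$ appears in $Q$. The vertex congestion of $\mathcal{P}$ is $\max_{v\in V}\sum_{Q\in\mathcal{P}}c_v^Q$. The vertex congestion of $G$ is the smallest integer $g$ for which $G$ has an all-pairs set of paths with vertex congestion $g$. *)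

(* Defs.v *)
From HB Require Import structures.
From mathcomp Require Import all_boot all_order all_algebra.
From mathcomp Require Import all_classical all_reals all_analysis.

Set Implicit Arguments.
Unset Strict Implicit.
Unset Printing Implicit Defensive.

Import Order.TTheory GRing.Theory Num.Theory.
Import numFieldNormedType.Exports.

Local Open Scope classical_set_scope.
Local Open Scope ring_scope.

Section Congestion.
Variables (V : finType) (e : rel V).

(* As in [path], the starting vertex is kept apart: the path from u to v is the
   vertex sequence u :: Q u v.  Simplicity forces the path from u to u to be
   (u). *)
Definition all_pairs_paths (Q : V -> V -> seq V) : Prop :=
  forall u v, [/\ path e u (Q u v), last u (Q u v) = v & uniq (u :: Q u v)].

Definition paths_congestion (Q : V -> V -> seq V) : nat :=
  \max_(w : V) \sum_(u : V) \sum_(v : V) count_mem w (u :: Q u v).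

Definition is_vertex_congestion (g : nat) : Prop :=
  (exists2 Q, all_pairs_paths Q & paths_congestion Q = g) /\
  (forall Q, all_pairs_paths Q -> (g <= paths_congestion Q)%N).

End Congestion.

Section LocalSearch.
Variables (R : realType) (V : finType).

Definition local_min (e : rel V) (f : V -> R) (v : V) : Prop :=
  forall u, e v u -> f v <= f u.

Inductive action := Query of V | Answer of V.

(* Past queries with the oracle's replies, oldest first. *)
Definition history := seq (V * R).

(* A deterministic adaptive algorithm; it need not halt. *)
Definition strategy := history -> action.

Definition step (s : strategy) (f : V -> R) (h : history) : history :=
  if s h is Query v then rcons h (v, f v) else h.

Definition transcript (s : strategy) (f : V -> R) (k : nat) : history :=
  iter k (step s f) [::].

Definition outputs (s : strategy) (f : V -> R) (v : V) : Prop :=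
  exists k, s (transcript s f k) = Answer v.

(* The size of the transcript grows by one per query and is constant after an
   answer, so this is the number of queries, and +oo if s does not halt on f. *)
Definition nqueries (s : strategy) (f : V -> R) : \bar R :=
  ereal_sup (range (fun k => ((size (transcript s f k))%:R : R)%:E)).

(* The coins are a point of an arbitrary probability space. *)
Record rand_alg := RandAlg {
  ra_disp : measure_display;
  ra_coins : measurableType ra_disp;
  ra_prob : probability ra_coins R;
  ra_run : ra_coins -> strategy;
  ra_meas : forall (h : history) (a : action),
    measurable [set w | ra_run w h = a] }.

Arguments ra_prob : clear implicits.
Arguments ra_run : clear implicits.

Definition correct (e : rel V) (A : rand_alg) : Prop :=
  forall f : V -> R,
    ((9 / 10)%:E <=
     ra_prob A [set w | exists2 v, outputs (ra_run A w) f v & local_min e f v])%E.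

Definition expected_queries (A : rand_alg) (f : V -> R) : \bar R :=
  (\int[ra_prob A]_w nqueries (ra_run A w) f)%E.

Definition worst_case_queries (A : rand_alg) : \bar R :=
  ereal_sup (range (expected_queries A)).

Definition rand_query_complexity (e : rel V) : \bar R :=
  ereal_inf [set q | exists2 A, correct e A & worst_case_queries A = q].

End LocalSearch.

(* Main.v *)
Require Import Defs.
From HB Require Import structures.
From mathcomp Require Import all_boot all_order all_algebra.
From mathcomp Require Import all_classical all_reals all_analysis.
From mathcomp Require Import measurable_realfun ring lra.

Set Implicit Arguments.
Unset Strict Implicit.
Unset Printing Implicit Defensive.

Import Order.TTheory GRing.Theory Num.Theory.
Import numFieldNormedType.Exports.

Local Open Scope classical_set_scope.
Local Open Scope ring_scope.

(* Take all-pairs paths of congestion g and k + 2 independent uniform vertices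
   x_0, ..., x_(k+1), and join each x_i to x_(i+1) by the chosen path. The function
   that decreases along this staircase and equals the distance to x_0 off it has
   x_(k+1) as its only local minimum.

   Reveal one new vertex x_(t+1) per query for free: as long as no query hits an
   unrevealed part of the staircase, query number t is a function of x_0, ..., x_t.
   For i > t it meets the path from x_i to x_(i+1) with probability at most g / n^2,
   these two ends being independent of it. So, outside an event of probability at
   most k^2 g / n^2, what is known after k queries depends on x_0, ..., x_k only,
   and the answer is x_(k+1) with probability 1 / n. Hence k queries succeed with
   probability at most k^2 g / n^2 + 1 / n, and Yao's principle gives a lower bound
   of order n / sqrt g, which dominates n^1.5 / g because g >= n. *)

(** * Staircase functions *)

Section LastOccurrence.
Variable V : eqType.
Implicit Types (s : seq V) (v : V).

(* One plus the position of the last occurrence of v in s, and 0 if there is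
   none. *)
Definition last_occ s v : nat := (size s - index v (rev s))%N.

Lemma last_occ_cat s1 s2 v : v \notin s2 -> last_occ (s1 ++ s2) v = last_occ s1 v.
Proof.
move=> vs2; rewrite /last_occ rev_cat index_cat mem_rev (negPf vs2) size_rev.
by rewrite size_cat [X in (X - _)%N]addnC subnDl.
Qed.

Lemma last_occ_cat_ge s1 s2 v : v \in s2 -> (size s1 < last_occ (s1 ++ s2) v)%N.
Proof.
move=> vs2; rewrite /last_occ rev_cat index_cat mem_rev vs2 size_cat.
have : (index v (rev s2) < size s2)%N by rewrite -size_rev index_mem mem_rev.
by move=> h; rewrite -(addnBA _ (ltnW h)) -addn1 leq_add2l subn_gt0.
Qed.

Lemma split_last_occ s v : v \in s ->
  exists s1 s2, s = s1 ++ v :: s2 /\ v \notin s2.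
Proof.
elim: s => // a s IH; case: (boolP (v \in s)) => [/IH [s1 [s2 [-> h]]] _|h].
  by exists (a :: s1), s2.
by rewrite inE (negPf h) orbF => /eqP va; exists [::], s; rewrite -va.
Qed.

End LastOccurrence.

Section Distance.
Variables (V : finType) (e : rel V).
Hypothesis e_conn : forall u v : V, connect e u v.

Lemma walk_of_some_length u v :
  exists n, [exists p : n.-tuple V, path e u p && (last u p == v)].
Proof.
have /connectP [p up ->] := e_conn u v; exists (size p).
by apply/existsP; exists (in_tuple p); rewrite up /=.
Qed.

(** Walks run from [v] towards [u], so the first edge of a shortest one leads from [v] to a vertex
    closer to [u]. *)
Definition dist u v : nat := ex_minn (walk_of_some_length v u).

Lemma dist_decr u v : v != u -> exists2 w, e v w & (dist u w < dist u v)%N.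
Proof.
move=> vu; rewrite /dist; case: ex_minnP => n /existsP [p /andP [vp lp]] _.
case: p vp lp => -[|w p] //= sp; first by rewrite (negPf vu).
move=> /andP [vw wp] lp; exists w => //; case: ex_minnP => m _ /(_ (size p)) h.
rewrite -(eqP sp) ltnS h //; apply/existsP; exists (in_tuple p).
by rewrite wp /=.
Qed.

End Distance.

Section Staircase.
Variables (R : realType) (V : finType) (e : rel V) (Q : V -> V -> seq V).
Hypothesis e_conn : forall u v : V, connect e u v.
Hypothesis Q_paths : all_pairs_paths e Q.
Implicit Types (x y : nat -> V) (m k : nat) (v : V).

Fixpoint stairs x m : seq V :=
  if m is k.+1 then stairs x k ++ Q (x k) (x k.+1) else [:: x 0%N].

(** A staircase may revisit vertices; valuing a vertex by its last visit makes the vertex right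
    after that visit strictly smaller. Values are negative on the staircase and at least 0 off
    it. *)
Definition stair_fun x m v : R :=
  if v \in stairs x m then - (last_occ (stairs x m) v)%:R
  else (dist e_conn (x 0%N) v)%:R.

Lemma eq_stairs x y m : (forall i, (i <= m)%N -> x i = y i) ->
  stairs x m = stairs y m.
Proof.
elim: m => [|m IH] xy /=; first by rewrite xy.
by rewrite IH ?xy// => i im; rewrite xy// ltnW.
Qed.

Lemma eq_stair_fun x y m : (forall i, (i <= m)%N -> x i = y i) ->
  stair_fun x m = stair_fun y m.
Proof.
by move=> xy; rewrite /stair_fun (eq_stairs xy) xy.
Qed.

(** Appending segments that avoid [v] does not move its last visit, whose position is counted from
    the front. *)
Lemma stair_fun_prefix x k m v : (k <= m)%N ->
  (forall i, (k <= i < m)%N -> v \notin Q (x i) (x i.+1)) ->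
  stair_fun x m v = stair_fun x k v.
Proof.
elim: m => [|m IH]; first by rewrite leqn0 => /eqP ->.
rewrite leq_eqVlt ltnS => /predU1P [-> //|km] vQ.
rewrite -IH//; last by move=> i /andP [ki im]; rewrite vQ// ki ltnW.
have vm : v \notin Q (x m) (x m.+1) by rewrite vQ// km ltnSn.
by rewrite /stair_fun /= mem_cat (negPf vm) orbF last_occ_cat.
Qed.

Lemma stairs_path x m : exists p,
  [/\ stairs x m = x 0%N :: p, path e (x 0%N) p & last (x 0%N) p = x m].
Proof.
elim: m => [|m [p [p0 p1 p2]]] /=; first by exists [::].
have [q1 q2 _] := Q_paths (x m) (x m.+1).
exists (p ++ Q (x m) (x m.+1)); split; first by rewrite p0.
  by rewrite cat_path p1 p2.
by rewrite last_cat p2.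
Qed.

Lemma stair_fun_local_min x m v : local_min e (stair_fun x m) v -> v = x m.
Proof.
move=> vmin; have [p [sE sp sl]] := stairs_path x m.
case: (boolP (v \in stairs x m)) => vs.
  have [s1 [s2 [s12 vs2]]] := split_last_occ vs.
  case: s2 => [|u s2] in s12 vs2.
    have := congr1 (last v) s12; rewrite sE /= sl => ->.
    by rewrite last_cat.
  (* The successor [u] of the last visit to [v] is itself last visited later, so its value is
     smaller. *)
  have evu : e v u.
    have : sorted e (stairs x m) by rewrite sE.
    by rewrite s12 sorted_cat_cons => /andP [_ /=/andP[]].
  have us : u \in stairs x m by rewrite s12 mem_cat !inE eqxx !orbT.
  have := vmin u evu; rewrite /stair_fun vs us lerN2 ler_nat s12 leqNgt.
  rewrite -cat_rcons last_occ_cat//.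
  rewrite (leq_ltn_trans (leq_subr _ _))//.
  by rewrite last_occ_cat_ge// inE eqxx.
have vx0 : v != x 0%N by apply: contraNneq vs => ->; rewrite sE inE eqxx.
(* A step towards [x 0] reaches either a smaller distance or a staircase vertex, of negative
   value. *)
have [u evu du] := dist_decr e_conn vx0.
have := vmin u evu; rewrite /stair_fun (negPf vs).
case: ifP => _; last by rewrite ler_nat leqNgt du.
move=> h; have : (dist e_conn (x 0%N) v)%:R <= 0 :> R.
  by rewrite (le_trans h)// oppr_le0 ler0n.
by rewrite lern0 => /eqP d0; rewrite d0 in du.
Qed.

End Staircase.

(** * Staircases with random milestones *)

Section Resampling.
Variables I V : finType.
Implicit Types (X : {ffun I -> V}) (i : I) (a : V).

Definition resample X i a : {ffun I -> V} :=
  [ffun j => if j == i then a else X j].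

(** A uniform [X] stays uniform when one coordinate is redrawn: swapping [a] with [X i] is an
    involution on the pairs [(X, a)]. *)
Lemma sum_resample (h : {ffun I -> V} -> nat) i :
  (#|V| * \sum_X h X = \sum_X \sum_a h (resample X i a))%N.
Proof.
rewrite pair_big /=.
rewrite (reindex_inj (h := fun u : {ffun I -> V} * V =>
  (resample u.1 i u.2, u.1 i))) /=; last first.
  apply: (can_inj (g := fun u => (resample u.1 i u.2, u.1 i))) => -[X a] /=.
  rewrite ffunE eqxx; congr pair; apply/ffunP => j; rewrite !ffunE.
  by case: eqP => [->|].
rewrite -(pair_big xpredT xpredT (fun X a =>
  h (resample (resample X i a) i (X i)))) /= big_distrr/=.
apply: eq_bigr => X _; rewrite -sum_nat_const; apply: eq_bigr => a _.
by congr h; apply/ffunP => j; rewrite !ffunE; case: eqP => [->|].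
Qed.

End Resampling.

Section Simulation.
Variables (R : realType) (V : finType) (e : rel V) (Q : V -> V -> seq V).
Hypothesis e_conn : forall u v : V, connect e u v.
Variables (s : strategy R V) (K : nat).
Implicit Types (x y : nat -> V) (t i : nat).

Local Notation stair_fun := (stair_fun R Q e_conn).

(* The run of s in which query number t (from 0) is answered as if the staircase
   stopped at x (t + 1). Query number t thus depends on x 0, ..., x t only. *)
Fixpoint sim x t : history R V :=
  if t is k.+1 then step s (stair_fun x k.+1) (sim x k) else [::].

Lemma eq_sim x y t : (forall i, (i <= t)%N -> x i = y i) -> sim x t = sim y t.
Proof.
elim: t => //= t IH xy; rewrite (eq_stair_fun _ _ _ xy) IH// => i it.
by rewrite xy// ltnW.
Qed.

(** Of interest for [t < i] only: the reply to query [t] uses segments 0 to [t]. *)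
Definition lucky x t i : bool :=
  if s (sim x t) is Query v then v \in Q (x i) (x i.+1) else false.

Lemma transcript_sim x t : (t <= K)%N ->
  (forall t i, (t < i <= K)%N -> ~~ lucky x t i) ->
  transcript s (stair_fun x K.+1) t = sim x t.
Proof.
move=> tK unlucky; elim: t tK => //= t IH tK.
rewrite IH ?(ltnW tK)// /step.
case E : (s (sim x t)) => [v|//].
rewrite (@stair_fun_prefix _ _ _ _ _ x t.+1)// => [|i iK]; first exact: leqW.
by have := unlucky t i iK; rewrite /lucky E.
Qed.

Local Notation milestones := {ffun 'I_K.+2 -> V}.
Definition milestone (X : milestones) i : V := X (inord i).

Lemma milestone_resample (X : milestones) i j a : (i < K.+2)%N -> (j < K.+2)%N ->
  milestone (resample X (inord j) a) i = if i == j then a else milestone X i.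
Proof.
by move=> iK jK; rewrite /milestone ffunE -val_eqE /= !inordK.
Qed.

(** Query [t] depends on milestones 0 to [t], so redrawing milestones [i] and [i.+1] leaves it
    fixed; the pairs of ends whose path meets it number at most the congestion. *)
Lemma sum_lucky t i : (t < i <= K)%N ->
  (#|V| * (#|V| * \sum_X lucky (milestone X) t i) <=
   paths_congestion Q * #|{: milestones}|)%N.
Proof.
move=> /andP [ti iK]; rewrite (sum_resample _ (inord i)).
rewrite (sum_resample _ (inord i.+1)) mulnC -sum_nat_const; apply: leq_sum => X _.
pose ab a b := resample (resample X (inord i.+1) b) (inord i) a.
have iK1 : (i < K.+2)%N by rewrite ltnW.
have abE a b j : (j < K.+2)%N -> milestone (ab a b) j =
    if j == i then a else if j == i.+1 then b else milestone X j.
  by move=> jK; rewrite !milestone_resample.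
have sim_ab a b : sim (milestone (ab a b)) t = sim (milestone X) t.
  apply: eq_sim => j jt; have ji := leq_ltn_trans jt ti.
  by rewrite abE ?(ltn_trans ji)// ltn_eqF// ltn_eqF// ltnW.
case E : (s (sim (milestone X) t)) => [v|v]; last first.
  rewrite big1// => b _; rewrite big1// => a _.
  by rewrite /lucky -/(ab a b) sim_ab E.
rewrite exchange_big /= (leq_trans _ (leq_bigmax v))//.
apply: leq_sum => a _; apply: leq_sum => b _.
rewrite /lucky -/(ab a b) sim_ab E !abE// eqxx gtn_eqF//.
rewrite -has_pred1 has_count/= (leq_trans _ (leq_addl _ _))//. by rewrite eqxx; case: count.
Qed.

Definition answers (h : history R V) (v : V) : bool :=
  if s h is Answer u then u == v else false.

(** The last milestone does not influence the simulated run, so redrawing it matches the answer for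
    at most one value. *)
Lemma sum_sim_answers :
  (#|V| * \sum_X answers (sim (milestone X) K) (milestone X K.+1) <=
   #|{: milestones}|)%N.
Proof.
rewrite (sum_resample _ (inord K.+1)) -sum1_card; apply: leq_sum => X _.
have simK a : sim (milestone (resample X (inord K.+1) a)) K = sim (milestone X) K.
  apply: eq_sim => j jK.
  by rewrite milestone_resample ?ltn_eqF// ltnW.
under eq_bigr => a _ do rewrite simK milestone_resample// eqxx.
rewrite /answers; case: (s _) => [v|v]; first by rewrite big1.
by rewrite (bigD1 v)//= eqxx big1// => u; rewrite eq_sym => /negPf ->.
Qed.

Lemma sum_answers :
  (#|V| ^ 2 * \sum_(X : milestones)
      answers (transcript s (stair_fun (milestone X) K.+1) K) (milestone X K.+1)
   <= (K ^ 2 * paths_congestion Q + #|V|) * #|{: milestones}|)%N.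
Proof.
set T := #|{: milestones}|; set g := paths_congestion Q.
(* Union bound: either some query hits an unrevealed segment [j.+1], or the true transcript is the
   simulated one. *)
have pt (X : milestones) :
    (answers (transcript s (stair_fun (milestone X) K.+1) K) (milestone X K.+1) <=
     \sum_(t < K) \sum_(j < K | t <= j) lucky (milestone X) t j.+1 +
     answers (sim (milestone X) K) (milestone X K.+1))%N.
  case: (boolP [exists t : 'I_K, exists j : 'I_K,
      (t <= j)%N && lucky (milestone X) t j.+1]) => [|nolucky].
    move=> /existsP [t /existsP [j /andP [tj ltj]]].
    rewrite (bigD1 t)//= (bigD1 j)//= ltj -!addnA.
    exact: (leq_trans (leq_b1 _) (leq_addr _ _)).
  rewrite transcript_sim// ?leq_addl// => t [//|j] /andP [tj jK].
  apply: contra nolucky => ltj; apply/existsP; exists (Ordinal (leq_trans tj jK)).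
  by apply/existsP; exists (Ordinal jK); rewrite ltj andbT.
apply: (@leq_trans (#|V| ^ 2 * (\sum_(t < K) \sum_(j < K | t <= j)
    \sum_(X : milestones) lucky (milestone X) t j.+1 +
    \sum_X answers (sim (milestone X) K) (milestone X K.+1)))).
  rewrite leq_mul2l; apply/orP; right.
  under [X in (X + _)%N]eq_bigr => t _ do rewrite exchange_big /=.
  by rewrite exchange_big/= -big_split /= leq_sum.
rewrite mulnDr mulnDl leq_add//; last first.
  by rewrite -mulnn -mulnA leq_mul2l sum_sim_answers orbT.
rewrite big_distrr/=.
(* The pairs with [t <= j] are bounded by all [K ^ 2] pairs. *)
have -> : (K ^ 2 * g * T = \sum_(t < K) \sum_(j < K) g * T)%N.
  by rewrite !sum_nat_const !card_ord -mulnn !mulnA.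
apply: leq_sum => t _; rewrite big_distrr/= [leqRHS](bigID (fun j : 'I_K => (t <= j)%N)) /=.
apply: leq_trans (leq_addr _ _); apply: leq_sum => j tj.
by rewrite -mulnn -mulnA sum_lucky// ltnS tj ltn_ord.
Qed.

End Simulation.

(** * From deterministic to randomized algorithms *)

Section Halting.
Variables (R : realType) (V : finType).
Implicit Types (s : strategy R V) (f : V -> R) (k m : nat) (v : V).

Lemma transcriptS s f k :
  transcript s f k.+1 = step s f (transcript s f k).
Proof. by []. Qed.

Lemma transcript_answered s f k m v : s (transcript s f k) = Answer v ->
  (k <= m)%N -> transcript s f m = transcript s f k.
Proof.
move=> sv; elim: m => [|m IH]; first by rewrite leqn0 => /eqP ->.
rewrite leq_eqVlt => /predU1P [<- //|km].
by rewrite transcriptS IH// /step sv.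
Qed.

Lemma outputs_answered s f k u v : s (transcript s f k) = Answer u ->
  outputs s f v -> v = u.
Proof.
move=> su [m sv]; have [km|/ltnW mk] := leqP k m.
  by move: sv; rewrite (transcript_answered su km) su => -[].
by move: su; rewrite (transcript_answered sv mk) sv => -[].
Qed.

Lemma size_transcript_running s f k v :
  s (transcript s f k) = Query v -> size (transcript s f k) = k.
Proof.
elim: k v => // k IH v; rewrite transcriptS.
rewrite /step; case E : (s (transcript s f k)) => [u|u]; last by rewrite E.
by rewrite size_rcons (IH _ E).
Qed.

Definition solves (e : rel V) s f k : Prop :=
  exists2 v, s (transcript s f k) = Answer v & local_min e f v.

(** A strategy that has not answered after [k] steps makes one more query; one that has answered can
    output nothing else. *)
Lemma outputs_cases (e : rel V) s f k :
  (exists2 v, outputs s f v & local_min e f v) ->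
  solves e s f k \/ size (transcript s f k.+1) = k.+1.
Proof.
move=> [v vo vmin]; case E : (s (transcript s f k)) => [u|u].
  right; rewrite transcriptS /step E size_rcons.
  by rewrite (size_transcript_running E).
by left; exists u => //; rewrite -(outputs_answered E vo).
Qed.

End Halting.

Section Measurability.
Variables (R : realType) (V : finType) (A : rand_alg R V) (f : V -> R).

(** Histories carry reals and are uncountable, but on a fixed [f] a transcript is determined by the
    queried vertices; events thus split into countable unions. *)
Let replies (us : seq V) : history R V := [seq (v, f v) | v <- us].

Let transcript_replies s k : exists us, transcript s f k = replies us.
Proof.
elim: k => [|k [us IH]]; first by exists [::].
rewrite transcriptS IH /step.
by case: (s _) => [v|_]; [exists (rcons us v); rewrite /replies map_rcons|exists us].
Qed.

Lemma measurable_run_action (Phi : action V -> Prop) h :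
  measurable [set w | Phi (ra_run (r := A) w h)].
Proof.
rewrite [X in measurable X](_ : _ =
  \bigcup_(v in [set v | Phi (Query v)]) [set w | ra_run (r := A) w h = Query v] `|`
  \bigcup_(v in [set v | Phi (Answer v)]) [set w | ra_run (r := A) w h = Answer v]).
  by apply: measurableU; apply: fin_bigcup_measurable => // v _; exact: ra_meas.
apply/seteqP; split => w /=; last by case=> -[v /= Pv ->].
by case E : (ra_run w h) => [v|v] Pv; [left|right]; exists v.
Qed.

Let measurable_transcript_eq k us :
  measurable [set w | transcript (ra_run (r := A) w) f k = replies us].
Proof.
elim: k us => [|k IH] us.
  rewrite /transcript/=; case: (pselect ([::] = replies us)) => h.
    by rewrite [X in measurable X](_ : _ = setT)//; apply/seteqP; split.
  by rewrite [X in measurable X](_ : _ = set0)//; apply/seteqP; split.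
rewrite [X in measurable X](_ : _ = \bigcup_(vs : seq V)
  ([set w | transcript (ra_run (r := A) w) f k = replies vs] `&`
   [set w | (if ra_run (r := A) w (replies vs) is Query v
             then rcons (replies vs) (v, f v) else replies vs) = replies us])).
  apply: countable_bigcupT_measurable => // vs; apply: measurableI => //.
  exact: (measurable_run_action (fun a => (if a is Query v
    then rcons (replies vs) (v, f v) else replies vs) = replies us)).
apply/seteqP; split => w /=.
  have [vs E] := transcript_replies (ra_run w) k.
  by rewrite E => h; exists vs.
by move=> [vs _ [/= E h]]; rewrite E.
Qed.

Lemma measurable_transcript (Phi : history R V -> action V -> Prop) k :
  measurable [set w | Phi (transcript (ra_run (r := A) w) f k)
    (ra_run w (transcript (ra_run (r := A) w) f k))].
Proof.
rewrite [X in measurable X](_ : _ = \bigcup_(vs : seq V)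
  ([set w | transcript (ra_run (r := A) w) f k = replies vs] `&`
   [set w | Phi (replies vs) (ra_run w (replies vs))])).
  apply: countable_bigcupT_measurable => // vs; apply: measurableI => //.
  exact: measurable_run_action.
apply/seteqP; split => w /=; last by move=> [vs _ [/= ->]].
by have [vs E] := transcript_replies (ra_run w) k; exists vs => //; rewrite /= -E.
Qed.

Lemma measurable_solves (e : rel V) k :
  measurable [set w | solves e (ra_run (r := A) w) f k].
Proof.
exact: (measurable_transcript
  (fun _ a => exists2 v, a = Answer v & local_min e f v)).
Qed.

Lemma measurable_correct (e : rel V) : measurable
  [set w | exists2 v, outputs (ra_run (r := A) w) f v & local_min e f v].
Proof.
rewrite [X in measurable X](_ : _ =
  \bigcup_k [set w | solves e (ra_run (r := A) w) f k]).
  by apply: bigcupT_measurable => k; exact: measurable_solves.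
apply/seteqP; split => w /=.
  by move=> [v [k sv] vmin]; exists k => //; exists v.
by move=> [k _ [v sv vmin]]; exists v => //; exists k.
Qed.

Import HBNNSimple.

(** Markov's inequality: [k] times the indicator of the event that all [k] steps are queries is a
    simple function below [nqueries]. *)
Lemma expected_queries_ge k :
  (k%:R%:E * ra_prob A [set w | size (transcript (ra_run (r := A) w) f k) = k]
   <= expected_queries A f)%E.
Proof.
have mS := measurable_transcript (fun h _ => size h = k) k.
have nq0 w : (0 <= nqueries (ra_run (r := A) w) f)%E.
  by apply: le_ereal_sup_tmp; exists 0%E => //; exists 0%N.
rewrite /expected_queries ge0_integralTE//; apply: ereal_sup_ubound.
pose h := scale_nnsfun (indic_nnsfun R mS) (ler0n R k).
have hE w : h w = k%:R * \1_[set w | size (transcript (ra_run (r := A) w) f k) = k] w.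
  by [].
exists h => [w|]; last by rewrite sintegralrM sintegral_indic.
rewrite hE indicE; case: (boolP (w \in _)) => [|_]; last by rewrite mulr0.
rewrite inE /= mulr1 => sz; apply: ereal_sup_ubound; exists k => //.
by rewrite sz.
Qed.

End Measurability.

Section Averaging.
Variables (R : realType) (V : finType) (e : rel V) (A : rand_alg R V).

(** Yao's principle for a uniform instance [F i]: the average success probability within [k] queries
    is at most [p], so by correctness some instance needs [k.+1] queries with probability at least
    [9 / 10 - p]. *)
Lemma worst_case_queries_ge (I : finType) (F : I -> V -> R) (p : R) k :
  correct e A -> (0 < #|I|)%N ->
  (forall s, (\sum_i `[< solves e s (F i) k >])%:R <= p * #|I|%:R) ->
  (((9 / 10 - p) * k.+1%:R)%:E <= worst_case_queries A)%E.
Proof.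
move=> Acorrect I0 Fhard; set P := ra_prob A.
pose S i := [set w | solves e (ra_run (r := A) w) (F i) k].
pose L i := [set w | size (transcript (ra_run (r := A) w) (F i) k.+1) = k.+1].
have mS i : measurable (S i) by exact: measurable_solves.
have mL i : measurable (L i).
  exact: (measurable_transcript A (F i) (fun h _ => size h = k.+1) k.+1).
have PSL i : 9 / 10 <= fine (P (S i)) + fine (P (L i)).
  rewrite -lee_fin EFinD !fineK ?fin_num_measure//.
  apply: le_trans (Acorrect (F i)) _.
  apply: le_trans (measureU2 _ (mS i) (mL i)).
  apply: le_measure; rewrite ?inE; first exact: measurable_correct.
    exact: measurableU.
  by move=> w /(outputs_cases k).
have sumS : \sum_i fine (P (S i)) <= p * #|I|%:R.
  rewrite -lee_fin -sumEFin.
  under eq_bigr => i _ do rewrite fineK ?fin_num_measure//.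
  (* This is the expected number of instances solved; [Fhard] bounds that number for each outcome of
     the coins. *)
  have -> : (\sum_i P (S i) = \int[P]_w (\sum_i (\1_(S i) w)%:E))%E.
    rewrite ge0_integral_sum//.
    - by apply: eq_bigr => i _; rewrite integral_indic// setIT.
    - move=> i; apply/measurable_EFinP; exact: measurable_indic.
  rewrite -[leRHS]mule1 -(probability_setT P) -integral_cst//.
  apply: ge0_le_integral => //.
  - by move=> w _; apply: sume_ge0 => i _; rewrite lee_fin.
  - apply: emeasurable_sum => i; apply/measurable_EFinP; exact: measurable_indic.
  move=> w _ /=; rewrite sumEFin lee_fin (le_trans _ (Fhard (ra_run w)))//.
  rewrite natr_sum; apply: ler_sum => i _; rewrite indicE ler_nat.
  by rewrite /S; case: asboolP => [|h]; rewrite ?leq_b1// memNset.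
have [i Li] : exists i, 9 / 10 - p <= fine (P (L i)).
  apply/not_existsP => small.
  suff : \sum_(i : I) (9 / 10 - p) < \sum_(i : I) (9 / 10 - p) by rewrite ltxx.
  rewrite [X in X < _](_ : _ = (9 / 10) * #|I|%:R - p * #|I|%:R); last first.
    by rewrite sumr_const -[LHS]mulr_natr mulrBl.
  apply: (@le_lt_trans _ _ (\sum_i fine (P (L i)))).
    rewrite lerBlDl (le_trans _ (lerD sumS (lexx _)))// -big_split/=.
    rewrite mulr_natr -sumr_const; exact: ler_sum.
  have /card_gt0P [i0 _] := I0.
  apply: ltr_sum => [|i _]; last by rewrite ltNge; exact/negP/small.
  by apply/hasP; exists i0 => //; rewrite mem_index_enum.
apply: (@le_trans _ _ (expected_queries A (F i))); last first.
  by apply: ereal_sup_ubound; exists (F i).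
apply: le_trans (expected_queries_ge _ _ k.+1).
rewrite -/(L i) -[X in (_ * X)%E]fineK ?fin_num_measure// -EFinM lee_fin mulrC.
by rewrite ler_wpM2l.
Qed.

End Averaging.

(** * The final estimate *)

Lemma card_le_vertex_congestion (V : finType) (e : rel V) g :
  is_vertex_congestion e g -> (#|V| <= g)%N.
Proof.
move=> [[Q _ <-] _]; case: (pickP V) => [v _|V0]; last by rewrite eq_card0.
(* Each of the [#|V|] paths starting at [v] counts [v] at least once. *)
apply: leq_trans (leq_bigmax v); rewrite -sum1_card [leqRHS](bigD1 v)//=.
rewrite (leq_trans _ (leq_addr _ _))//; apply: leq_sum => u _.
by rewrite eqxx.
Qed.

(** The only possible local minimum is the last milestone, so solving the instance means guessing
    that milestone. *)
Lemma sum_solves (R : realType) (V : finType) (e : rel V) (Q : V -> V -> seq V)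
    (e_conn : forall u v, connect e u v) (s : strategy R V) k :
  all_pairs_paths e Q ->
  (#|V| ^ 2 * \sum_(X : {ffun 'I_k.+2 -> V})
      `[< solves e s (stair_fun R Q e_conn (milestone X) k.+1) k >] <=
   (k ^ 2 * paths_congestion Q + #|V|) * #|{ffun 'I_k.+2 -> V}|)%N.
Proof.
move=> Q_paths; apply: leq_trans (sum_answers Q e_conn s k).
rewrite leq_mul2l; apply/orP; right; apply: leq_sum => X _.
case: asboolP => // -[v sv vmin]; rewrite /answers sv.
by rewrite (stair_fun_local_min Q_paths vmin) eqxx.
Qed.

Theorem theorem1 (R : realType) :
  exists2 c : R, 0 < c & exists n0 : nat,
    forall (V : finType) (e : rel V),
      symmetric e -> irreflexive e -> (forall u v : V, connect e u v) ->
      (n0 <= #|V|)%N ->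
      forall g : nat, is_vertex_congestion e g ->
        ((c * ((#|V|%:R : R) `^ (3 / 2)) / g%:R)%:E
           <= rand_query_complexity R e)%E.
Proof.
(* [1 / 4] is [9 / 10 - 2 / 5], where [2 / 5] bounds the success probability, times the factor
   [1 / 2] in the choice of [k]. *)
exists (1 / 4); first lra.
exists 7 => V e _ _ e_conn n7 g gcong.
have ng := card_le_vertex_congestion gcong.
have g0 : 0 < g%:R :> R by rewrite ltr0n (leq_trans _ ng)// (leq_trans _ n7).
case: gcong => -[Q Q_paths Qg] _.
set n : R := #|V|%:R; set y := n `^ (3 / 2).
have y0 : 0 <= y by exact: powR_ge0.
have yy : y ^+ 2 = n ^+ 3.
  rewrite -powR_mulrn// -powRrM -powR_mulrn ?ler0n//; congr (_ `^ _); lra.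
(* [k] is the integer part of [y / (2 * g)], so [k.+1] exceeds this quotient. *)
have /truncn_itv /andP [] : 0 <= y / (2 * g%:R).
  by rewrite divr_ge0// mulr_ge0// ltW.
set k := Num.trunc _; rewrite ler_pdivlMr ?mulr_gt0// => ky yk.
have n0 : 0 < n by rewrite ltr0n (leq_trans _ n7).
have gn : n <= g%:R by rewrite ler_nat.
have k0 : 0 <= k%:R :> R by [].
(* Squaring [2 k g <= y] gives [4 k^2 g^2 <= n^3]; then [n <= g] trades a factor [g] for [n]. *)
have kg : 4 * (k%:R ^+ 2 * g%:R) <= n ^+ 2.
  have h : (k%:R * (2 * g%:R)) ^+ 2 <= n ^+ 3.
    by rewrite -yy ler_sqr ?nnegrE// mulr_ge0// mulr_ge0// ltW.
  rewrite -(ler_pM2r n0) -exprSr (le_trans _ h)//.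
  rewrite [leRHS](_ : _ = 4 * (k%:R ^+ 2 * g%:R) * g%:R); last by ring.
  by rewrite ler_wpM2l// mulr_ge0// mulr_ge0 ?exprn_ge0// ltW.
apply: le_ereal_inf_tmp => _ [A Acorrect <-].
pose F (X : {ffun 'I_k.+2 -> V}) := stair_fun R Q e_conn (milestone X) k.+1.
apply: le_trans (@worst_case_queries_ge _ _ e A _ F (2 / 5) k Acorrect _ _).
- rewrite lee_fin (_ : 1 / 4 * y / g%:R = (9 / 10 - 2 / 5) * (y / (2 * g%:R))).
    by rewrite ler_wpM2l//; [lra|exact: ltW].
  by field; rewrite gt_eqF.
- by rewrite card_ffun card_ord expn_gt0 (leq_trans _ n7).
move=> s; have := sum_solves e_conn s k Q_paths; rewrite Qg.
rewrite -(ler_nat R) !natrM natrD natrM !natrX -/n => h.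
set S := (X in X <= _); set T := #|_|%:R in h *.
have T0 : 0 <= T by exact: ler0n.
rewrite -(ler_pM2l (exprn_gt0 2 n0)) (le_trans h)//.
rewrite mulrA ler_wpM2r//.
(* There remains [k^2 g + n <= 2/5 n^2]. By [kg] it suffices that [1/4 + 1/n <= 2/5], that is
   [n >= 20/3], whence the threshold 7. *)
have n7R : 7 <= n by rewrite (ler_nat R 7).
nra.
Qed.
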